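(* Let $X$ be a Tychonoff space that is locally compact, scattered, hereditarily meta-Lindelöf, and of height $\omega_1$. Then every open cover of $X$ has a point finite clopen refinement.
   Context: A space is scattered if every nonempty subspace of it has an isolated point. For a scattered space $X$, the $\alpha$-th scattering level $X^{(\alpha)}$ is the set of isolated points of $X\setminus\bigcup_{\beta<\alpha}X^{(\beta)}$; the height of $X$ is the least ordinal $\alpha$ with $X^{(\alpha)}=\varnothing$. A refinement of a family $\mathcal{F}$ of subsets of $X$ is a family $\mathcal{G}$ with $\bigcup\mathcal{F}=\bigcup\mathcal{G}$ such that each $G\in\mathcal{G}$ is contained in some $F\in\mathcal{F}$; it is an open (clopen) refinement if all its members are open (clopen) in $X$. A family is point finite (point countable) if each point belongs to only finitely (countably) many of its members. A space is meta-Lindelöf if every open cover has a point countable open refinement, and hereditarily meta-Lindelöf if every subspace is meta-Lindelöf. *)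

(* Defs.v *)
From HB Require Import structures.
From mathcomp Require Import all_boot all_order.
From mathcomp Require Import all_classical.
From mathcomp Require Import topology normedtype.

Set Implicit Arguments.
Unset Strict Implicit.
Unset Printing Implicit Defensive.

Import Order.TTheory.

Local Open Scope classical_set_scope.
Local Open Scope order_scope.

Definition tychonoff_space (X : topologicalType) : Prop :=
  completely_regular_space X /\ hausdorff_space X.

Definition scattered_space (X : topologicalType) : Prop :=
  forall A : set X, A !=set0 -> isolated A !=set0.

Section Families.
Context {X : topologicalType}.
Implicit Types F G : set (set X).

Definition open_cover F : Prop :=
  F `<=` open /\ \bigcup_(U in F) U = [set: X].

Definition refinement F G : Prop :=
  \bigcup_(U in F) U = \bigcup_(V in G) V /\
  forall V, G V -> exists2 U, F U & V `<=` U.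

Definition open_refinement F G : Prop := refinement F G /\ G `<=` open.

Definition clopen_refinement F G : Prop := refinement F G /\ G `<=` clopen.

Definition point_finite G : Prop :=
  forall x : X, finite_set [set V | G V /\ V x].

Definition point_countable G : Prop :=
  forall x : X, countable [set V | G V /\ V x].

End Families.

Definition meta_lindelof (X : topologicalType) : Prop :=
  forall F : set (set X), open_cover F ->
  exists2 G, open_refinement F G & point_countable G.

(* [set_type A] carries the subspace topology; the library's [subspace A] would
   instead keep the points outside of [A] as isolated points. *)
Definition hereditarily_meta_lindelof (X : topologicalType) : Prop :=
  forall A : set X, meta_lindelof (set_type A).

(* An ordinal alpha is represented by a well-ordered type W of order type
   alpha, given as a total order whose strict part is well founded. The elements
   w of W stand for the ordinals beta < alpha: w stands for the order type of
   the initial segment below w. *)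
Section Levels.
Context (X : topologicalType) (d : Order.disp_t) (W : orderType d).
Hypothesis wfW : well_founded (fun v w : W => v < w).

Definition scattering_level : W -> set X :=
  Fix wfW (fun=> set X) (fun w level =>
    isolated (~` [set x | exists v (vw : v < w), level v vw x])).

Lemma scattering_levelE (w : W) :
  scattering_level w =
  isolated (~` \bigcup_(v in [set v | v < w]) scattering_level v).
Proof.
rewrite {1}/scattering_level Fix_eq; last first.
  move=> u f g fg; congr (isolated (~` _)); apply/seteqP.
  by split=> x [v [vu]] h; exists v, vu; move: h; rewrite fg.
congr (isolated (~` _)); apply/seteqP.
by split=> [x [v [vw h]]|x [v vw h]]; exists v => //; exists vw.
Qed.

(* The scattering level X^(alpha) indexed by the order type alpha of W. *)
Definition scattering_level_at : set X :=
  isolated (~` \bigcup_(v in [set: W]) scattering_level v).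

(* The order type alpha of W is the least ordinal with X^(alpha) empty. *)
Definition has_height : Prop :=
  scattering_level_at = set0 /\ forall w, scattering_level w !=set0.

End Levels.

(* For a well-ordered W: the order type of W is the least uncountable ordinal. *)
Definition is_omega1 (d : Order.disp_t) (W : orderType d) : Prop :=
  ~ countable [set: W] /\ forall w : W, countable [set v | v < w].

(* Main.v *)
(* Ranking the points by their scattering level, every point x has compact open
   neighbourhoods, arbitrarily small, whose other points have smaller rank. The
   meta-Lindelof property of X bounds by a countable ordinal the ranks of the
   x whose neighbourhood contains a given y; applied to the subspaces of points
   of rank at most w it bounds their number on each level. This yields a point
   countable family of compact open V x containing x and refining the cover.

   To make it point finite, cover the compact intersection of V a and V b by the
   V t with t in K a b, a finite subset of that intersection, and call A
   saturated if it is closed under K and contains every x such that V x meets A.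
   If y lies in the union of the V a, a in A, a point b of least rank in A with
   y in V b satisfies: b lies in every V a, a in A, that contains y. Well-order
   X and exhaust it by the increasing saturated hulls A i of initial segments,
   shrink each family (V a), a in A i, by induction, and keep at stage i only the
   indices that appear first in A i. Only finitely many stages concern a given y:
   otherwise infinitely many of them have no maximum, the union of their hulls is
   saturated, the point b attached to y lies in some A i of them, and so do all
   later indices a with y in V a, since b lies in V a. *)
Require Import Defs.
From mathcomp Require Import all_boot all_order.
From mathcomp Require Import all_classical wochoice.
From mathcomp Require Import topology normedtype.

Set Implicit Arguments.
Unset Strict Implicit.
Unset Printing Implicit Defensive.

Import Order.TTheory.

Local Open Scope classical_set_scope.

Lemma countable_setU (T : Type) (A B : set T) :
  countable A -> countable B -> countable (A `|` B).
Proof.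
move=> cA cB; rewrite -bigcup2E; apply: bigcup_countable => [|i _].
  exact: countableP.
by case: i => [|[|i]] //=; exact: countable0.
Qed.

(** * Well-founded relations and well-orderings *)

Section WellFounded.
Variables (T : Type) (lt : T -> T -> Prop).
Hypothesis wf : well_founded lt.

Lemma wf_minimal (P : set T) : P !=set0 ->
  exists2 m, P m & forall x, P x -> ~ lt x m.
Proof.
move=> [x Px]; apply: contrapT => nomin.
elim/(well_founded_ind wf): x Px => x IH Px; apply: nomin.
by exists x => // y Py /IH; exact.
Qed.

Hypothesis tri : forall x y, [\/ lt x y, x = y | lt y x].

(** A subset of [S] whose proper initial segments are finite is finite, being empty or one such
    segment together with its maximum. Well-founded induction makes all initial segments of [S]
    finite, and the same argument then applies to [S]. *)
Lemma finite_set_maximal (S : set T) :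
  (forall P, P `<=` S -> P !=set0 -> exists2 m, P m & forall x, P x -> ~ lt m x) ->
  finite_set S.
Proof.
move=> Smax.
have step P : P `<=` S ->
    (forall x, P x -> finite_set (P `&` [set y | lt y x])) -> finite_set P.
  move=> PS fP; have [->//|/set0P/(Smax _ PS)[m Pm mmax]] := eqVneq P set0.
  apply: (@sub_finite_set _ _ ((P `&` [set y | lt y m]) `|` [set m])).
    by move=> x Px; have [?|->|/(mmax _ Px)] := tri x m; [left|right|].
  by rewrite finite_setU; split=> //; exact: fP.
have fI x : finite_set (S `&` [set y | lt y x]).
  elim/(well_founded_ind wf): x => x IH; apply: step => [y []//|y [Sy yx]].
  by apply: sub_finite_set (IH _ yx) => z [[]].
exact: step.
Qed.

End WellFounded.

Lemma well_order_exists (T : eqType) : exists lt : T -> T -> Prop,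
  [/\ well_founded lt, (forall x y, [\/ lt x y, x = y | lt y x]) &
      forall x y z, lt x y -> lt y z -> lt x z].
Proof.
have [R Rwo] := well_ordering_principle T.
have Rchain : wo_chain R (@predT T) by move=> A _; exact: Rwo.
have Rtot x y : R x y || R y x by apply: (wo_chainW Rchain).
have Ranti x y : R x y -> R y x -> x = y.
  by move=> xy yx; apply: (wo_chain_antisymmetric Rchain) => //; rewrite xy.
pose lt x y := ~~ R y x.
have wf : well_founded lt.
  move=> x; apply: contrapT => nx.
  have [|z [[/asboolP nz zmin] _]] := Rwo [pred y | `[< ~ Acc lt y >]].
    by exists x; apply/asboolP.
  apply: nz; constructor => y zy; apply: contrapT => ny.
  by move/negP: zy; apply; apply: zmin; apply/asboolP.
have irr x : ~ lt x x by rewrite /lt -[R x x]orbb Rtot.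
have tri x y : [\/ lt x y, x = y | lt y x].
  rewrite /lt; case: (boolP (R y x)) => [yx|]; last by constructor 1.
  case: (boolP (R x y)) => [xy|]; last by constructor 3.
  by constructor 2; exact: Ranti.
exists lt; split=> // x y z xy yz.
have asym a b : lt a b -> ~ lt b a.
  rewrite /lt => ab ba; have /orP[] := Rtot a b; first exact/negP.
  exact/negP.
have [//|xz|zx] := tri x z; first by rewrite -xz in yz; case: (asym _ _ xy).
(* A cycle through [x], [y], [z] would leave this set without a minimal element. *)
have [|m mP mmin] := @wf_minimal _ _ wf [set u | [\/ u = x, u = y | u = z]].
  by exists x; constructor 1.
case: mP => mE; rewrite mE in mmin.
- by have := mmin z (Or33 _ _ erefl).
- by have := mmin x (Or31 _ _ erefl).
- by have := mmin y (Or32 _ _ erefl).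
Qed.

(** * Saturated sets and hulls *)

Section Saturation.
Variables (X : Type) (V : X -> set X) (K : X -> X -> set X).

Definition saturated (A : set X) :=
  (forall a b, A a -> A b -> K a b `<=` A) /\
  (forall a x, A a -> V x a -> A x).

Definition hull := smallest saturated.

Lemma saturated_hull C : saturated (hull C).
Proof.
split=> [a b ha hb x kx A [satA CA]|a x ha xa A [satA CA]].
  by apply: (satA.1 a b) => //; [apply: ha|apply: hb].
by apply: (satA.2 a) => //; apply: ha.
Qed.

Lemma sub_hull C D : C `<=` D -> hull C `<=` hull D.
Proof. by apply: sub_smallest2r; exact: saturated_hull. Qed.

(** Closure under [K] involves two points; the chain condition puts both into one member. *)
Lemma saturated_bigcup (I : Type) (D : set I) (A : I -> set X) :
  (forall i, D i -> saturated (A i)) ->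
  (forall i j, D i -> D j -> A i `<=` A j \/ A j `<=` A i) ->
  saturated (\bigcup_(i in D) A i).
Proof.
move=> satA chain; split=> [a b [i Di ia] [j Dj jb]|a x [i Di ia] xa].
  have [ij|ji] := chain i j Di Dj => x kx.
    by exists j => //; apply: (satA j Dj).1 kx => //; exact: ij.
  by exists i => //; apply: (satA i Di).1 kx => //; exact: ji.
by exists i => //; exact: (satA i Di).2 ia xa.
Qed.

Hypothesis Kcount : forall a b, countable (K a b).
Hypothesis Vcount : forall y, countable [set x | V x y].

(** Closing off in countably many rounds reaches a saturated set, and each round adds countably many
    points. *)
Lemma countable_hull C : countable C -> countable (hull C).
Proof.
move=> cC.
pose next A := A `|` \bigcup_(p in A `*` A) (K p.1 p.2 `|` [set x | V x p.1]).
pose C_ := fix C_ n := if n is m.+1 then next (C_ m) else C.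
have cC_ n : countable (C_ n).
  elim: n => // n IH; apply: countable_setU => //; apply: bigcup_countable.
    exact: countableX.
  by move=> p _; exact: countable_setU.
have C_S n : C_ n `<=` C_ n.+1 by move=> x; left.
have mono m n : (m <= n)%N -> C_ m `<=` C_ n.
  elim: n => [|n IH]; first by rewrite leqn0 => /eqP->.
  rewrite leq_eqVlt ltnS => /orP[/eqP->//|/IH mn].
  exact: subset_trans (C_S n).
suff /(@smallest_sub _ saturated): saturated (\bigcup_n C_ n).
  move=> /(_ C) h; apply: (@sub_countable _ _ _ (\bigcup_n C_ n)).
    by apply: subset_card_le; apply: h; exact: (@bigcup_sup _ _ 0).
  exact: bigcup_countable.
split=> [a b [m _ ma] [n _ nb] x kx|a x [m _ ma] xa].
  exists (maxn m n).+1 => //; right; exists (a, b) => /=; last by left.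
  by split; [apply: mono ma; exact: leq_maxl|apply: mono nb; exact: leq_maxr].
by exists m.+1 => //; right; exists (a, a) => //=; right.
Qed.

End Saturation.

(** * From point countable to point finite *)

Section PointFiniteShrinking.
Variables (X : topologicalType) (V : X -> set X).

(** Finiteness counts indices rather than sets, so that a family glued from several stages can be
    counted stage by stage. *)
Definition point_finite_shrinking (A : set X) (V' : X -> set X) :=
  [/\ forall a, A a -> clopen (V' a) /\ V' a `<=` V a,
      forall a, A a -> V a `<=` \bigcup_(b in A) V' b &
      forall y, finite_set [set a | A a /\ V' a y]].

Hypothesis Vclopen : forall x, clopen (V x).

(** Enumerate [A] and remove from each [V a] the finitely many earlier sets: the remainders are
    clopen and pairwise disjoint. *)
Lemma countable_shrinking A : countable A -> exists V', point_finite_shrinking A V'.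
Proof.
move=> /countable_injP[f finj].
pose earlier a := [set b | A b /\ (f b < f a)%N].
have fin a : finite_set (earlier a).
  rewrite -(eq_finite_set (inj_card_eq (f := f) _)).
    by apply: (@sub_finite_set _ _ `I_(f a)) => // n [b [_ ba] <-].
  by move=> b c /set_mem[Ab _] /set_mem[Ac _]; apply: finj; exact: mem_set.
exists (fun a => V a `\` \bigcup_(b in earlier a) V b); split.
- move=> a Aa; split; last exact: subDsetl.
  rewrite setDE; apply: clopenI => //; apply: (clopenC set0); split.
    by apply: bigcup_open => b _; have [] := Vclopen b.
  by apply: closed_bigcup => // b _; have [] := Vclopen b.
- move=> a Aa y ay.
  have wfn : well_founded (fun m n => (m < n)%N).
    by move=> n; elim/ltn_ind: n => n IH; constructor.
  have [m [b [Ab <- yb]] mmin] := @wf_minimal _ _ wfn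
    [set n | exists b, [/\ A b, f b = n & V b y]] 
    (ex_intro _ _ (ex_intro _ a (And3 Aa erefl ay))).
  exists b => //; split=> // -[c [Ac cb] yc].
  by apply: (mmin (f c)); [exists c|].
- move=> y; set S := [set a | _].
  have [->//|/set0P[a [Aa [ay na]]]] := eqVneq S set0.
  apply: (@sub_finite_set _ _ [set a]) => // b [Ab [yb nb]] /=.
  apply: finj; [exact: mem_set|exact: mem_set|].
  by case: (ltngtP (f b) (f a)) => // [ba|ab];
    [case: na; exists b|case: nb; exists a].
Qed.

Variables (W : Type) (ltW : W -> W -> Prop) (rank : X -> W) (K : X -> X -> set X).
Hypothesis wfW : well_founded ltW.
Hypothesis Vrank : forall x y, V x y -> y <> x -> ltW (rank y) (rank x).
Hypothesis Vcount : forall y, countable [set x | V x y].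
Hypothesis Kcount : forall a b, countable (K a b).
Hypothesis Ksub : forall a b, K a b `<=` V a `&` V b.
Hypothesis Kcover : forall a b, V a `&` V b `<=` \bigcup_(t in K a b) V t.

(* Take b of least rank in A with y in V b: if V a contains y but not b, then y
   is in V t for some t in K a b, a point of A of smaller rank. *)
Lemma saturated_trace A y a0 : saturated V K A -> A a0 -> V a0 y ->
  exists2 b, A b & forall a, A a -> V a y -> V a b.
Proof.
move=> [satK _] Aa0 a0y.
have [|_ [b [Ab yb <-]] bmin] := @wf_minimal _ _ wfW
    [set w | exists b, [/\ A b, V b y & rank b = w]].
  by exists (rank a0), a0.
exists b => // a Aa ya; apply: contrapT => nab.
have [|t abt ty] := @Kcover a b y; first by [].
have [at_ bt] := Ksub abt.
apply: (bmin (rank t)); first by exists t; split=> //; exact: satK abt.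
by apply: Vrank => // tb; apply: nab; rewrite -tb.
Qed.

Variable lt : X -> X -> Prop.
Hypothesis wf : well_founded lt.
Hypothesis tri : forall x y, [\/ lt x y, x = y | lt y x].
Hypothesis trans : forall x y z, lt x y -> lt y z -> lt x z.

Let H := hull V K.

(* The hypothesis carries an arbitrary countable C so that it also covers the
   hulls of initial segments including their last point. *)
Lemma shrinking_step D :
  (forall i, D i -> forall C, countable C -> exists V',
    point_finite_shrinking (H (C `|` (D `&` [set j | lt j i]))) V') ->
  forall C, countable C -> exists V', point_finite_shrinking (H (C `|` D)) V'.
Proof.
move=> IH C cC.
have [D0|/set0P [d0 Dd0]] := eqVneq D set0.
  by rewrite D0 setU0; apply: countable_shrinking; exact: countable_hull.
(* Including [i] itself makes these hulls exhaust the hull of [C] and [D]; for [IH] it is absorbed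
   into the countable set. *)
pose A i := H (C `|` [set i] `|` (D `&` [set j | lt j i])).
have satA i : saturated V K (A i) by exact: saturated_hull.
have A_mono i j : D i -> lt i j -> A i `<=` A j.
  move=> Di ij; apply: sub_hull => x [[Cx|->]|[Dx xi]].
  - by left; left.
  - by right.
  - by right; split=> //; exact: trans ij.
have A_chain i j : D i -> D j -> A i `<=` A j \/ A j `<=` A i.
  by move=> Di Dj; have [ij|->|ji] := tri i j;
    [left; exact: A_mono|left|right; exact: A_mono].
have HA x : H (C `|` D) x -> exists2 i, D i & A i x.
  have : H (C `|` D) `<=` \bigcup_(i in D) A i.
    apply: smallest_sub; first exact: saturated_bigcup.
    move=> y [Cy|Dy].
      by exists d0 => //; apply: sub_gen_smallest; left; left.
    by exists y => //; apply: sub_gen_smallest; left; right.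
  exact.
have AH i : D i -> A i `<=` H (C `|` D).
  by move=> Di; apply: sub_hull => x [[Cx|->]|[Dx xi]]; [left|right|right].
have /choice[V_ V_P] i : exists V', D i -> point_finite_shrinking (A i) V'.
  have [Di|nDi] := pselect (D i); last by exists V.
  have [|V' V'P] := IH i Di (C `|` [set i]); last by exists V'.
  exact: countable_setU.
(* [s a] is the first stage whose hull contains [a]. *)
have /choice[s sP] a : exists i, H (C `|` D) a ->
    [/\ D i, A i a & forall j, D j -> A j a -> ~ lt j i].
  have [Ha|nHa] := pselect (H (C `|` D) a); last by exists a.
  have [i Di Aia] := HA a Ha.
  have [j [Dj Aja] jmin] := @wf_minimal _ _ wf (D `&` [set j | A j a])
    (ex_intro _ i (conj Di Aia)).
  by exists j => _; split=> // k Dk Aka; exact: jmin.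
exists (fun a => V_ (s a) a); split.
- by move=> a /sP[Ds As _]; have [+ _ _] := V_P _ Ds; exact.
- move=> a Ha y ay.
  (* At the first stage with an index [b] such that [y] is in [V b], the index [c] found below is
     new, so [s c = i] and its set is kept. *)
  have [i [Di [b Aib yb]] imin] := @wf_minimal _ _ wf
    (D `&` [set i | exists2 b, A i b & V b y])
    (let: And3 Ds As _ := sP a Ha in
      ex_intro _ (s a) (conj Ds (ex_intro2 _ _ a As ay))).
  have [V_sub V_cov _] := V_P i Di.
  have [c Aic yc] := V_cov b Aib y yb.
  exists c; first exact: AH Aic.
  have [Dsc Asc smin] := sP c (AH i Di c Aic).
  suff -> : s c = i by [].
  have cy := (V_sub c Aic).2 y yc.
  have [sci|//|isc] := tri (s c) i.
    by case: (imin (s c)) => //; split=> //; exists c.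
  by case: (smin i).
- move=> y; pose S := [set i | exists a, [/\ H (C `|` D) a, s a = i & V a y]].
  have finS : finite_set S.
    apply: (finite_set_maximal wf tri) => P PS [i0 Pi0].
    apply: contrapT => nomax.
    have PD i : P i -> D i by move=> /PS[a [/sP[Ds _ _] <- _]].
    have satB : saturated V K (\bigcup_(i in P) A i).
      by apply: saturated_bigcup => // i j /PD Di /PD Dj; exact: A_chain.
    have PA i : P i -> exists a, [/\ H (C `|` D) a, s a = i, A i a & V a y].
      by move=> /PS[a [Ha <- ay]]; exists a; split=> //; have [] := sP a Ha.
    have [a0 [Ha0 sa0 Aa0 a0y]] := PA i0 Pi0.
    have [|b [i1 Pi1 i1b] btrace] := saturated_trace satB _ a0y.
      by exists i0.
    (* The stage [i1] is maximal in [P]: an index [a2] new at a later stage has [b] in [V a2], so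
       saturation already puts it into [A i1]. *)
    apply: nomax; exists i1 => // i2 Pi2 i12.
    have [a2 [Ha2 sa2 Aa2 a2y]] := PA i2 Pi2.
    have a2b : V a2 b by apply: btrace => //; exists i2.
    have [_ _ smin] := sP a2 Ha2.
    apply: (smin i1); [exact: PD| |by rewrite sa2].
    exact: (satA i1).2 i1b a2b.
  apply: (@sub_finite_set _ _
    (\bigcup_(i in S) [set a | A i a /\ V_ i a y])).
    move=> a [Ha ya]; have [Ds As _] := sP a Ha.
    exists (s a) => //; exists a; split=> //.
    by have [/(_ a As)[_ sub] _ _] := V_P _ Ds; exact: sub.
  apply: bigcup_finite => // i [a [/sP[Ds _ _] <- _]].
  by have [_ _ +] := V_P _ Ds; exact.
Qed.

(** Well-founded induction treats the initial segments; one more step, with all of [X] in place of a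
    segment and [C] empty, finishes. *)
Lemma shrinking_exists : exists V', point_finite_shrinking setT V'.
Proof.
have IH i : forall C, countable C -> exists V',
    point_finite_shrinking (H (C `|` [set j | lt j i])) V'.
  elim/(well_founded_ind wf): i => i IH; apply: shrinking_step => j ji C cC.
  have -> : [set j | lt j i] `&` [set k | lt k j] = [set k | lt k j].
    by apply/seteqP; split=> [k []//|k kj]; split=> //; exact: trans ji.
  exact: IH.
have -> : [set: X] = H (set0 `|` setT).
  by apply/seteqP; split=> // x _; apply: sub_gen_smallest; right.
apply: shrinking_step => // i _ C cC; rewrite setTI; exact: IH.
Qed.

End PointFiniteShrinking.

(* [compact_cover] is only available for pointed spaces. *)
Lemma compact_finite_subcover (X : topologicalType) (I : Type) (A : set X)
    (D : set I) (L : I -> set X) :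
  compact A -> (forall i, D i -> open (L i)) -> A `<=` \bigcup_(i in D) L i ->
  exists E, [/\ finite_set E, E `<=` D & A `<=` \bigcup_(i in E) L i].
Proof.
move=> /compact_near_coveringP cA oL AL.
(* This filter is generated by the cones above the finite subsets of [D]; a cone on which [A] is
   covered has the required finite set as its vertex. *)
pose F : set_system (set I) := [set P | exists E0,
  [/\ finite_set E0, E0 `<=` D & forall E, E0 `<=` E -> P E]].
have FF : Filter F.
  split.
  - by exists set0; split=> //; exact: sub0set.
  - move=> P Q [E0 [fE0 E0D PE]] [E1 [fE1 E1D QE]]; exists (E0 `|` E1).
    split; [by rewrite finite_setU|by rewrite subUset|].
    by move=> E; rewrite subUset => -[E0E E1E]; split; [exact: PE|exact: QE].
  - move=> P Q PQ [E0 [fE0 E0D PE]]; exists E0; split=> // E /PE; exact: PQ.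
have [x Ax|E [fE ED EA]] := cA _ F (fun E x => (\bigcup_(i in E) L i) x) FF.
  have [i Di ix] := AL x Ax.
  exists (L i, [set E | E i]).
    split; first by apply: open_nbhs_nbhs; split=> //; exact: oL.
    exists [set i]; split=> //; first by move=> _ ->.
    by move=> E; apply.
  by move=> [y E] /= [iy Ei]; exists i.
by exists E; split=> // x Ax; exact: EA Ax.
Qed.

(** * Ranks, compact open neighbourhoods and point countable assignments *)

Section CompactOpenNeighbourhoods.
Variables (X : topologicalType) (d : Order.disp_t) (W : orderType d).
Hypothesis wfW : well_founded (fun v w : W => (v < w)%O).

(** The rank is the index of the level: [x] is isolated outside the earlier levels, so its nearby
    points lie in those. If some points had no level, an isolated one among them would lie in the
    empty top level. *)
Lemma scattering_rank : scattered_space X -> scattering_level_at wfW = set0 :> set X ->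
  exists rank : X -> W, forall x,
    \forall y \near x, y <> x -> (rank y < rank x)%O.
Proof.
move=> scX top0; pose level := @scattering_level X d W wfW.
have levels x : exists w, level w x.
  apply: contrapT => nx; suff : @scattering_level_at X d W wfW !=set0.
    by rewrite top0 => -[].
  by apply: scX; exists x => -[w _ wx]; apply: nx; exists w.
have level_ge w v x : level w x -> level v x -> ~ (v < w)%O.
  rewrite /level scattering_levelE => /isolatedS xw xv vw.
  by apply: xw; exists v.
have level_inj w v x : level w x -> level v x -> w = v.
  move=> xw xv; case: (ltgtP w v) => // [wv|vw].
    by case: (level_ge v w x).
  by case: (level_ge w v x).
have [rank rankP] := choice levels; exists rank => x.
have := rankP x; rewrite /level scattering_levelE => -[_ [V Vx VE]].
apply: filterS Vx => y Vy yx.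
have [v /= vx yv] : (\bigcup_(v in [set v | (v < rank x)%O]) level v) y.
  apply: contrapT => ny; apply: yx.
  by have : [set x] y by rewrite -VE; split.
by rewrite (level_inj _ _ _ (rankP y) yv).
Qed.

Hypothesis hX : hausdorff_space X.
Hypothesis lcX : locally_compact [set: X].
Variable rank : X -> W.
Hypothesis rankP : forall x, \forall y \near x, y <> x -> (rank y < rank x)%O.

(* The part of a small compact neighbourhood of x outside of its interior consists
   of points of smaller rank: by induction it is covered by finitely many compact
   open sets missing x, which are then removed. *)
Lemma compact_open_nbhs x (O : set X) : nbhs x O ->
  exists L, [/\ compact L, open L, L x & L `<=` O].
Proof.
move: {2}(rank x) (erefl (rank x)) => w; elim/(well_founded_ind wfW): w x O.
move=> w IH x O xw Ox.
have [K0 K0x [cK0 clK0]] := lcX (x := x) I.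
have {}K0x : nbhs x K0.
  by apply: filterS (K0x : {near nbhs x, [set: X] `<=` K0}) => y; exact.
have [B Bx BO] : filter_from (nbhs x) closure
    (O `&` K0 `&` [set y | y <> x -> (rank y < rank x)%O]).
  apply: (compact_regular hX cK0 K0x); apply: filterI; last exact: rankP.
  exact: filterI.
pose K := closure B; have clK : closed K by exact: closed_closure.
have cK : compact K by apply: subclosed_compact cK0 _ => // y /BO[[]].
have Kx : nbhs x K by apply: filterS Bx; exact: subset_closure.
have oCx : open (~` [set x]).
  by rewrite openC; apply: compact_closed => //; exact: compact_set1.
have /choice[L LP] y : exists L, K y -> y <> x ->
    [/\ compact L, open L, L y & L `<=` ~` [set x]].
  have [[Ky yx]|nKy] := pselect (K y /\ y <> x); last first.
    by exists set0 => Ky yx; case: nKy.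
  have [_ /(_ yx) ryx] := BO y Ky.
  have [||L LL] := IH (rank y) _ y (~` [set x]) erefl; first by rewrite -xw.
    exact: open_nbhs_nbhs.
  by exists L.
pose bd := K `&` ~` K°.
have bdP y : bd y -> K y /\ y <> x.
  by move=> [Ky nKy]; split=> // yx; apply: nKy; rewrite yx.
have : compact bd.
  by apply: compact_closedI => //; apply: open_closedC; exact: open_interior.
move=> /(@compact_finite_subcover _ X bd bd L)[||D [fD Dbd bdD]].
- by move=> y /bdP[Ky yx]; have [] := LP y Ky yx.
- move=> y bdy; exists y => //; have [Ky yx] := bdP y bdy.
  by have [] := LP y Ky yx.
have DP y : D y -> [/\ compact (L y), open (L y), L y y & L y `<=` ~` [set x]].
  by move=> /Dbd/bdP[Ky yx]; exact: LP.
pose M := \bigcup_(y in D) L y.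
have oM : open M by apply: bigcup_open => y /DP[].
have clM : closed M.
  by apply: closed_bigcup => // y /DP[cL _ _ _]; exact: compact_closed.
exists (K `\` M); split.
- by apply: compact_closedI => //; exact: open_closedC.
(* Since [M] contains [bd], removing [M] from [K] or from its interior gives the same set, hence an
   open one. *)
- rewrite (_ : K `\` M = K° `&` ~` M).
    by apply: openI; [exact: open_interior|exact: closed_openC].
  apply/seteqP; split=> y [Ky nMy]; split=> //; last exact: interior_subset.
  by apply: contrapT => nKy; apply: nMy; apply: bdD.
- split; first exact: nbhs_singleton.
  by move=> [y /DP[_ _ _ Lx] /Lx]; apply.
- by move=> y [/BO[[]]].
Qed.

End CompactOpenNeighbourhoods.

(** Each [x] picks a member of a point countable refinement, and this is open in [X] because [A] is.
    Only the sets [g x] are counted, since many [x] may share one. *)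
Lemma meta_lindelof_assignment (X : topologicalType) (A : set X)
    (U : X -> set X) :
  open A -> meta_lindelof (set_type A) ->
  (forall x, A x -> open (U x) /\ U x x) ->
  exists g : X -> set X,
    [/\ forall x, A x -> open (g x) /\ g x x,
        forall x, A x -> exists2 z, A z & g x `<=` U z &
        forall y, countable [set g x | x in A `&` [set x | g x y]]].
Proof.
move=> oA mlA UP.
pose F := [set (set_val : A -> X) @^-1` U x | x in A].
have [|G [[FG GF] Go] Gc] := mlA F.
  split=> [_ [x Ax <-]|]; first by exists (U x) => //; have [] := UP x Ax.
  apply/seteqP; split=> // x _; exists (set_val @^-1` U (set_val x)).
    by exists (set_val x) => //; exact: set_valP.
  by have [] := UP (set_val x) (set_valP x).
have /choice[V VP] x : exists V : set A, A x ->
    G V /\ forall Ax : x \in A, V (exist _ x Ax).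
  have [/mem_set Ax|nAx] := pselect (A x); last by exists set0.
  have : (\bigcup_(V in F) V) (exist _ x Ax).
    exists (set_val @^-1` U x); first by exists x => //; exact: set_mem.
    by have [] := UP x (set_mem Ax).
  rewrite FG => -[V GV Vx]; exists V => _; split=> // Ax'.
  by rewrite (bool_irrelevance Ax' Ax).
exists (fun x => set_val @` V x); split.
- move=> x Ax; have [GV Vx] := VP x Ax; split.
    have [O oO OE] := Go _ GV.
    suff -> : set_val @` V x = O `&` A by exact: openI.
    rewrite -OE; apply/seteqP; split=> [_ [y Oy <-]|y [Oy /mem_set Ay]].
      by split=> //; exact: set_valP.
    by exists (exist _ y Ay).
  by exists (exist _ x (mem_set Ax)).
- move=> x Ax; have [/GF[_ [z Az <-] sub] _] := VP x Ax.
  by exists z => // _ [y Vy <-]; exact: sub.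
- move=> y; have [Ay|nAy] := pselect (A y); last first.
    rewrite (_ : [set _ | _ in _] = set0)//; apply/seteqP; split=> // B.
    by move=> [x [Ax [z _ zy]] _]; apply: nAy; rewrite -zy; exact: set_valP.
  pose y' : A := exist _ y (mem_set Ay).
  apply: (@sub_countable _ _ _ (image [set V | G V /\ V y'] (image^~ set_val))).
    apply: subset_card_le => _ [x [Ax [z Vz zy]] <-]; exists (V x) => //=.
    have [GV _] := VP x Ax; split=> //.
    by rewrite (_ : y' = z)//; exact: val_inj.
  exact: sub_countable (card_image_le _ _) (Gc y').
Qed.

(** * The point countable family and the final refinement *)

Theorem theorem3p2 (X : topologicalType)
    (d : Order.disp_t) (W : orderType d)
    (wfW : well_founded (fun v w : W => (v < w)%O)) :
  is_omega1 W ->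
  tychonoff_space X ->
  locally_compact [set: X]%classic ->
  scattered_space X ->
  hereditarily_meta_lindelof X ->
  has_height X wfW ->
  forall F : set (set X), open_cover F ->
  exists2 G : set (set X), clopen_refinement F G & point_finite G.
Proof.
move=> [_ cW] [_ hX] lcX scX mlX [top0 _] F [Fo FT].
have [rank rankP] := scattering_rank scX top0.
have basis := compact_open_nbhs wfW hX lcX rankP.
have /choice[U UP] x : exists U, [/\ open U, U x,
    forall y, U y -> y <> x -> (rank y < rank x)%O & exists2 B, F B & U `<=` B].
  have [B FB Bx] : (\bigcup_(B in F) B) x by rewrite FT.
  have [|L [_ oL Lx LB]] :=
      basis x (B `&` [set y | y <> x -> (rank y < rank x)%O]).
    by apply: filterI (rankP x); apply: open_nbhs_nbhs; split=> //; exact: Fo.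
  by exists L; split=> // [y /LB[_]//|]; exists B => // y /LB[].
have Ule x y : U x y -> (rank y <= rank x)%O.
  have [_ _ Ur _] := UP x => xy; have [->|/eqP yx] := eqVneq y x; first exact: lexx.
  exact/ltW/Ur.
pose level_le w := [set x | (rank x <= w)%O].
have level_open w : open (level_le w).
  rewrite openE => x xw; have [oU Ux _ _] := UP x.
  rewrite /interior nbhsE; exists (U x) => // y /Ule yx.
  exact: le_trans yx xw.
have assign A : open A -> _ := fun oA => meta_lindelof_assignment oA (mlX A)
  (fun x _ => let: And4 oU Ux _ _ := UP x in conj oU Ux).
(* [g] serves to bound ranks, [h w] to count the points of rank exactly [w]. *)
have [g [gP gU gcount]] := assign setT openT.
have /choice[h hP] w := assign (level_le w) (level_open w).
have /choice[V VP] x : exists V, [/\ compact V, open V, V x &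
    V `<=` U x `&` g x `&` h (rank x) x].
  have [oU Ux _ _] := UP x; have [og gx] := gP x I.
  have [/(_ x (lexx _))[oh hx] _ _] := hP (rank x).
  by apply: basis; apply: open_nbhs_nbhs; split=> //; do 2!apply: openI => //.
have Vclopen x : clopen (V x).
  by have [cV oV _ _] := VP x; split=> //; exact: compact_closed.
have level_count w y : countable [set x | rank x = w /\ h w x y].
  have [hopen hU hcount] := hP w; set S := [set x | _].
  (* If [h w x] lies in [U z] with [z] of rank at most [w], then [x], of rank [w], can only be [z];
     so [h w x] determines [x]. *)
  have hinj : {in S &, injective (h w)}.
    move=> x x' /set_mem[xw _] /set_mem[x'w _] hxx'.
    have lew u : rank u = w -> level_le w u by rewrite /level_le /= => ->.
    have [z zw hz] := hU x (lew x xw).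
    have top u : rank u = w -> h w u `<=` U z -> u = z.
      move=> uw huz; have [_ _ Ur _] := UP z; apply: contrapT => uz.
      have := Ur u (huz u (hopen u (lew u uw)).2) uz.
      by rewrite uw ltNge zw.
    by rewrite (top x)// (top x')// -hxx'.
  rewrite -(eq_countable (inj_card_eq hinj)).
  apply: sub_countable (hcount y); apply: subset_card_le => _ [x [xw xy] <-].
  by exists x => //; split=> //; rewrite /level_le /= xw.
have Vcount y : countable [set x | V x y].
  apply: (@sub_countable _ _ _
    (\bigcup_(B in [set g x | x in setT `&` [set x | g x y]])
      [set x | g x = B /\ V x y])).
    apply: subset_card_le => x xy; have [_ _ _ /(_ y xy)[[_ gxy] _]] := VP x.
    by exists (g x) => //; exists x.
  (* All [x] sharing the set [g x0] lie in one [U z], so their ranks are at most [rank z]: countably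
     many ranks, each settled by [level_count]. *)
  apply: bigcup_countable => // _ [x0 _ <-].
  have [z _ gz] := gU x0 I.
  apply: (@sub_countable _ _ _
    (\bigcup_(w in [set w | (w < rank z)%O] `|` [set rank z])
      [set x | rank x = w /\ h w x y])).
    apply: subset_card_le => x [gx xy].
    have [_ _ _ /(_ y xy)[_ hxy]] := VP x; exists (rank x) => //=.
    have : (rank x <= rank z)%O.
      by apply: Ule; apply: gz; rewrite -gx; have [] := gP x I.
    by rewrite le_eqVlt => /orP[/eqP|]; [right|left].
  by apply: bigcup_countable => //; apply: countable_setU.
have /choice[K KP] (p : X * X) : exists E, [/\ finite_set E,
    E `<=` V p.1 `&` V p.2 & V p.1 `&` V p.2 `<=` \bigcup_(t in E) V t].
  apply: compact_finite_subcover.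
  - by apply: compact_closedI; [have [] := VP p.1|have [] := Vclopen p.2].
  - by move=> i _; have [] := VP i.
  - by move=> x px; exists x => //; have [] := VP x.
have [lt [wf tri trans]] := well_order_exists X.
have [x y xy yx|a b|a b|a b|V' [V'P V'T V'fin]] :=
    @shrinking_exists X V Vclopen W _ rank (fun a b => K (a, b)) wfW _ Vcount
      _ _ _ lt wf tri trans.
- have [_ _ _ /(_ y xy)[[Uxy _] _]] := VP x.
  by have [_ _ + _] := UP x; exact.
- by apply: finite_set_countable; have [] := KP (a, b).
- by have [] := KP (a, b).
- by have [] := KP (a, b).
exists [set V' x | x in setT]; first split.
- split; last first.
    move=> _ [x _ <-]; have [_ V'V] := V'P x I; have [_ _ _ [B FB UB]] := UP x.
    by exists B => // y /V'V; have [_ _ _ VU] := VP x => /VU[[/UB]].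
  rewrite FT; apply/seteqP; split=> // x _.
  have [_ _ Vx _] := VP x; have [y _ V'yx] := V'T x I x Vx.
  by exists (V' y) => //; exists y.
- by move=> _ [x _ <-]; have [] := V'P x I.
move=> y; apply: (@sub_finite_set _ _ (V' @` [set x | setT x /\ V' x y])).
  by move=> _ [[x _ <-] xy]; exists x.
exact: finite_image.
Qed.
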